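(* There is a deterministic algorithm in the vertex oracle model that finds the global sink of an $i$-nice $n$-dimensional unique sink orientation $\psi$ using $O(n^{i+1})$ vertex evaluations.
   Context: Let $Q^n = 2^{[n]}$ be the vertex set of the $n$-cube, with $u,v$ adjacent iff $|u\oplus v|=1$; faces are $F_{J,v}=\{u : v\oplus u\subseteq J\}$ for $J\subseteq[n]$. A unique sink orientation (USO) is an orientation of the cube's edges such that every nonempty face has a unique sink (vertex with no outgoing edges within the face). The outmap $s_\psi(v)$ is the set of coordinates $j$ such that the edge $\{v,v\oplus\{j\}\}$ is directed away from $v$; the global sink is the vertex $t$ with $s_\psi(t)=\emptyset$. Let $d(v,u)$ be the length of a shortest directed path from $v$ to $u$ ($\infty$ if none). The reachmap is $r_\psi(v)=s_\psi(v)\cup\{j : \exists u \text{ reachable from } v \text{ by a directed path with } j\in s_\psi(u)\}$. A vertex $v$ is $i$-covered by $u$ if $d(v,u)\le i$ and $r_\psi(u)\subsetneq r_\psi(v)$; $\psi$ is $i$-nice if every vertex other than the global sink is $i$-covered by some vertex. In the vertex oracle model, a vertex evaluation is a query which, given $v$, returns $s_\psi(v)$. *)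

(* Defs.v *)
From mathcomp Require Import all_boot.
Set Implicit Arguments. Unset Strict Implicit. Unset Printing Implicit Defensive.

(* Vertices of the n-cube: subsets of [n] = 'I_n. *)
Definition vertex (n : nat) := {set 'I_n}.

Definition flip n (v : vertex n) (j : 'I_n) : vertex n :=
  if j \in v then v :\ j else j |: v.

(* An orientation is given by its outmap s : vertex -> set of outgoing coordinates. *)
Definition outmap n := vertex n -> {set 'I_n}.

Definition is_orientation n (s : outmap n) : Prop :=
  forall (v : vertex n) (j : 'I_n), (j \in s v) = (j \notin s (flip v j)).

Definition in_face n (J : {set 'I_n}) (v u : vertex n) : bool :=
  ((v :\: u) :|: (u :\: v)) \subset J.

Definition face_sink n (s : outmap n) (J : {set 'I_n}) (v u : vertex n) : bool :=
  in_face J v u && (s u :&: J == set0).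

Definition USO n (s : outmap n) : Prop :=
  is_orientation s /\
  forall (J : {set 'I_n}) (v : vertex n), exists! u, face_sink s J v u.

Definition arc n (s : outmap n) : rel (vertex n) :=
  fun u w => [exists j, (j \in s u) && (w == flip u j)].

Fixpoint dist_le n (s : outmap n) (k : nat) (v u : vertex n) : bool :=
  match k with
  | 0 => v == u
  | k'.+1 => (v == u) || [exists w, arc s v w && dist_le s k' w u]
  end.

Definition reachmap n (s : outmap n) (v : vertex n) : {set 'I_n} :=
  s v :|: [set j | [exists u, connect (arc s) v u && (j \in s u)]].

Definition covered_by n (s : outmap n) (i : nat) (v u : vertex n) : bool :=
  dist_le s i v u && (reachmap s u \proper reachmap s v).

Definition nice n (i : nat) (s : outmap n) : Prop :=
  forall v : vertex n, s v != set0 -> exists u, covered_by s i v u.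

(* Deterministic algorithms in the vertex oracle model: an adaptive strategy that,
   given the history of (queried vertex, returned outmap) pairs, either queries a
   new vertex or outputs an answer. *)
Inductive decision (n : nat) : Type :=
| Query of vertex n
| Output of vertex n.

Definition strategy (n : nat) := seq (vertex n * {set 'I_n}) -> decision n.

Fixpoint exec n (A : strategy n) (s : outmap n) (q : nat)
    (h : seq (vertex n * {set 'I_n})) : option (vertex n) :=
  match A h with
  | Output v => Some v
  | Query v => match q with
               | 0 => None
               | q'.+1 => exec A s q' (rcons h (v, s v))
               end
  end.

(* Main.v *)
(** If w is reachable from every vertex at distance at most i from v, then it is
    reachable from a vertex covering v, so its reachmap is strictly smaller than
    that of v. Hence it suffices to find such a w with O(n^i) queries and to
    iterate n times, the reachmap having at most n elements.

    For i = 1, query all out-neighbours u_j = v + j, j in s(v). If k is not in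
    s(u_j), then u_j is the sink of the 2-face {v, u_j, u_k, v + j + k} and hence
    reachable from u_k. Discarding such u_k as long as possible leaves a set T
    such that T \ {j} is contained in s(u_j) for all j in T. Then u_j is the
    source of the face it spans with w = v + T, and since a source reaches all
    of its face, w is reachable from all u_j.

    For i > 1, find recursively a vertex for i - 1 and each of the n
    out-neighbours, and join these vertices successively: two vertices x <> y
    are not both sinks of the face they span, so one of them has an outgoing edge
    leading closer to the other, and O(n) queries yield a vertex reachable from
    both. The joins cost O(n^2) in total, which O(n^i) absorbs. *)

Require Import Defs.
From mathcomp Require Import all_boot.

Set Implicit Arguments.
Unset Strict Implicit.
Unset Printing Implicit Defensive.

Section Cube.
Variable n : nat.
Implicit Types (v u : vertex n) (s : outmap n) (J : {set 'I_n}).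

(** * Symmetric differences, flips and faces *)

Definition symdiff v u : {set 'I_n} := (v :\: u) :|: (u :\: v).

Lemma in_symdiff v u j : (j \in symdiff v u) = (j \in v) (+) (j \in u).
Proof. by rewrite !inE; case: (j \in v); case: (j \in u). Qed.

Lemma in_flip v c j : (j \in flip v c) = (j \in v) (+) (j == c).
Proof.
by rewrite /flip; case: ifPn => cv; rewrite !inE; case: eqVneq => [->|_] //=;
   rewrite ?cv ?(negPf cv) ?addbF.
Qed.

Lemma flipK v c : flip (flip v c) c = v.
Proof. by apply/setP=> j; rewrite !in_flip addbK. Qed.

Lemma symdiffC v u : symdiff v u = symdiff u v.
Proof. by rewrite /symdiff setUC. Qed.

Lemma symdiff_eq0 v u : (symdiff v u == set0) = (v == u).
Proof.
apply/eqP/eqP=> [D0|->]; last by rewrite /symdiff setDv setU0.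
apply/setP=> j; have := in_symdiff v u j.
by rewrite D0 inE; case: (j \in v); case: (j \in u).
Qed.

Lemma symdiff_flip v u c :
  c \in symdiff v u -> symdiff v (flip u c) = symdiff v u :\ c.
Proof.
move=> cD; apply/setP=> j; move: cD; rewrite in_setD1 !in_symdiff in_flip.
by case: eqVneq => [->|_] /=; rewrite ?addbF // addbA => ->.
Qed.

Lemma card_symdiff_flip v u c :
  c \in symdiff v u -> #|symdiff v u| = #|symdiff v (flip u c)|.+1.
Proof. by move=> cD; rewrite (cardsD1 c (symdiff v u)) cD symdiff_flip. Qed.

Lemma face_sinkP s J v u :
  reflect (in_face J v u /\ forall c, c \in J -> c \notin s u) (face_sink s J v u).
Proof.
apply: (iffP andP) => -[Jvu sJ]; split=> //.
  move=> c cJ; apply/negP=> cs; move/eqP/setP/(_ c): sJ.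
  by rewrite !inE cs cJ.
apply/eqP/setP=> c; rewrite !inE; case: (boolP (c \in J)) => [/sJ/negPf->|] //.
by rewrite andbF.
Qed.

Lemma in_faceP J v u :
  reflect (forall c, c \notin J -> (c \in u) = (c \in v)) (in_face J v u).
Proof.
apply: (iffP subsetP) => H c.
  apply: contraNeq => neq; apply: H.
  by rewrite -/(symdiff v u) in_symdiff; move: neq; case: (c \in u); case: (c \in v).
rewrite -/(symdiff v u) in_symdiff; apply: contraLR => /H ->.
by rewrite addbb.
Qed.

(** * Unique sinks, unique sources and directed paths *)

Lemma USO_sink_inj s x y : USO s ->
  (forall c, c \in symdiff x y -> (c \notin s x) && (c \notin s y)) -> x = y.
Proof.
move=> [_ uso] H; have [u [_ Uu]] := uso (symdiff x y) x.
have xx : face_sink s (symdiff x y) x x.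
  apply/face_sinkP; split=> [|c /H/andP[] //].
  by apply/in_faceP.
have xy : face_sink s (symdiff x y) x y.
  apply/face_sinkP; split=> [|c /H/andP[] //].
  exact: subxx.
by rewrite -(Uu _ xx) -(Uu _ xy).
Qed.

(** If [c] lies in [J], direction [c] splits the face into two facets with one sink each. One of
    these is the sink of the face; at the other the [c]-edge goes out, so reversing direction [c]
    makes that one the new sink. *)
Lemma USO_flip s c : USO s -> USO (fun v => flip (s v) c).
Proof.
move=> us; have [or uso] := us; split.
  by move=> v j; rewrite !in_flip (or v) addNb.
move=> J v; case: (boolP (c \in J)) => cJ; last first.
  have E u : face_sink (fun v => flip (s v) c) J v u = face_sink s J v u.
    congr (_ && (_ == _)); apply/setP=> j; rewrite !inE in_flip.
    by case: eqVneq => [->|_]; rewrite ?(negPf cJ) ?andbF ?addbF.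
  have [u [Hu Uu]] := uso J v; exists u; split; first by rewrite E.
  by move=> u'; rewrite E; apply: Uu.
have sJ u : face_sink (fun v => flip (s v) c) J v u <->
    [/\ in_face J v u, c \in s u & forall j, j \in J :\ c -> j \notin s u].
  split.
    case/face_sinkP=> Ju H; split=> //.
      by have := H c cJ; rewrite in_flip eqxx addbT negbK.
    move=> j /setD1P[jc jJ]; have := H j jJ.
    by rewrite in_flip (negPf jc) addbF.
  case=> Ju cu H; apply/face_sinkP; split=> // j jJ; rewrite in_flip.
  case: eqVneq => [->|jc]; first by rewrite cu.
  by rewrite addbF H // !inE jc.
have [t [/face_sinkP[Jt st] Ut]] := uso J v.
have [t' [/face_sinkP[Jt' st'] _]] := uso (J :\ c) (flip t c).
have ctt' : (c \in t') = (c \notin t).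
  by rewrite (in_faceP _ _ _ Jt') ?in_flip ?eqxx ?addbT // !inE eqxx.
have Jvt' : in_face J v t'.
  apply/in_faceP=> j jJ; rewrite (in_faceP _ _ _ Jt').
    rewrite in_flip (in_faceP _ _ _ Jt) //.
    by case: eqVneq jJ => [->|]; rewrite ?cJ ?addbF.
  by rewrite !inE (negPf jJ) andbF.
have ct' : c \in s t'.
  apply/negPn/negP=> ct'; move: ctt'; rewrite -(Ut t'); first by case: (_ \in _).
  apply/face_sinkP; split=> // j jJ; case: (eqVneq j c) => [->//|jc].
  by apply: st'; rewrite !inE jc.
exists t'; split; first exact/sJ.
(* A sink of the flipped orientation cannot lie in the facet of t, whose only
   sink is t itself; hence it is the sink t' of the opposite facet. *)
have opp u : face_sink (fun v => flip (s v) c) J v u -> (c \in u) = (c \notin t).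
  case/sJ=> Ju cu su; apply/eqP/negPn/negP=> ctu.
  have Eut : u = t.
    apply: (USO_sink_inj us) => j; rewrite in_symdiff => jut.
    have jJ : j \in J.
      by apply: contraTT jut => jJ; rewrite (in_faceP _ _ _ Ju) // (in_faceP _ _ _ Jt) ?addbb.
    rewrite st // su // !inE jJ andbT; apply: contraNneq ctu => jc.
    by rewrite -jc; move: jut; case: (j \in u); case: (j \in t).
  by move: (st c cJ); rewrite -Eut cu.
move=> u Hu; apply: (USO_sink_inj us) => j; rewrite in_symdiff => jut.
have [Ju cu su] := (sJ u).1 Hu.
have jJ : j \in J :\ c.
  rewrite !inE; apply/andP; split.
    by apply: contraTneq jut => ->; rewrite (opp u) // ctt' addbb.
  by apply: contraTT jut => jJ; rewrite (in_faceP _ _ _ Ju) // (in_faceP _ _ _ Jvt') ?addbb.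
by rewrite st' // su.
Qed.

(** Directions are reversed one at a time; this turns unique sinks into unique sources. The
    complement is stated pointwise because the fold agrees with it only extensionally. *)
Lemma USO_reverse s : USO s -> exists2 s', USO s' & forall v, s' v = ~: s v.
Proof.
move=> us; pose s' l v := foldr (fun c a => flip a c) (s v) l.
exists (s' (enum 'I_n)).
  by elim: (enum _) => [|c l IH]; [exact: us | exact: USO_flip].
move=> v; apply/setP=> j; rewrite inE.
have : (j \in s' (enum 'I_n) v) = (j \in s v) (+) (j \in enum 'I_n).
  elim: (enum 'I_n) (enum_uniq 'I_n) => [|c l IH] /= => [_|/andP[cl /IH {}IH]].
    by rewrite addbF.
  rewrite in_flip IH inE -addbA; congr (_ (+) _).
  by case: eqVneq => [->|_]; rewrite ?(negPf cl) ?addbF.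
by rewrite mem_enum addbT.
Qed.

Lemma USO_source_inj s x y : USO s ->
  (forall c, c \in symdiff x y -> (c \in s x) && (c \in s y)) -> x = y.
Proof.
move=> /USO_reverse[s' us' s'E] H; apply: (USO_sink_inj us') => c /H.
by rewrite !s'E !inE !negbK.
Qed.

Lemma connect_flip s v c : c \in s v -> connect (Defs.arc s) v (flip v c).
Proof. by move=> cv; apply/connect1/existsP; exists c; rewrite cv eqxx. Qed.

(** Walk backwards from [z]: it is not a second source of the face spanned with [x], so some edge of
    that face enters it, from a vertex nearer to [x]. *)
Lemma connect_source s x z : USO s ->
  symdiff x z \subset s x -> connect (Defs.arc s) x z.
Proof.
move=> us; elim: {z}_.+1 {-2}z (ltnSn #|symdiff x z|) => // k IH z.
rewrite ltnS => ltk /subsetP xz.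
have [->|neq] := eqVneq x z; first exact: connect0.
have [c cxz cz] : exists2 c, c \in symdiff x z & c \notin s z.
  apply/exists_inP; apply: contraNT neq; rewrite negb_exists_in => /forall_inP H.
  apply/eqP/(USO_source_inj us) => c cD.
  by rewrite xz //; have := H c cD; rewrite negbK.
apply: (@connect_trans _ _ (flip z c)).
  apply: IH; first by rewrite -card_symdiff_flip.
  by rewrite symdiff_flip // (subset_trans (subsetDl _ _)) //; apply/subsetP.
by rewrite -{2}(flipK z c) connect_flip // us.1 flipK.
Qed.

(** The path goes through the vertex opposite to [v]. If its first edge were reversed, [flip v j]
    and [flip v k] would both be sinks of the 2-face. *)
Lemma connect_2face s v j k : USO s -> j \in s v -> k \in s v -> j != k ->
  k \notin s (flip v j) -> connect (Defs.arc s) (flip v k) (flip v j).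
Proof.
move=> us jv kv jk kj; have or := us.1.
have ju : j \notin s (flip v j) by rewrite -or.
have ku : k \notin s (flip v k) by rewrite -or.
have juk : j \in s (flip v k).
  apply: contraT => juk; have : flip v j = flip v k.
    apply: (USO_sink_inj us) => c; rewrite in_symdiff !in_flip addbACA addbb /=.
    by case: eqVneq => [->|_] /=; [rewrite ju juk | case: eqVneq => // -> _; rewrite kj ku].
  move/setP/(_ j); rewrite !in_flip eqxx (negPf jk) addbT addbF.
  by case: (_ \in _).
apply: connect_trans (connect_flip juk) _.
have -> : flip (flip v k) j = flip (flip v j) k.
  by apply/setP=> c; rewrite !in_flip addbAC.
by rewrite -{2}(flipK (flip v j) k) connect_flip // or flipK.
Qed.

Lemma reachmap_connect s v u : connect (Defs.arc s) v u -> reachmap s u \subset reachmap s v.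
Proof.
move=> vu; apply/subsetP=> j; rewrite !inE => H; apply/orP; right; apply/existsP.
case/orP: H => [ju|/existsP[w /andP[uw jw]]]; first by exists u; rewrite vu.
by exists w; rewrite (connect_trans vu uw).
Qed.

Lemma connect_sink s v u : s v = set0 -> connect (Defs.arc s) v u -> u = v.
Proof.
move=> v0 /connectP[[|w p] //= /andP[/existsP[j]]].
by rewrite v0 inE.
Qed.

(** * Query programs and their cost *)

Inductive prog (X : Type) : Type :=
| Ret of X
| Ask of vertex n & ({set 'I_n} -> prog X).

Fixpoint bind X Y (p : prog X) (f : X -> prog Y) : prog Y :=
  match p with
  | Ret x => f x
  | Ask v k => Ask v (fun a => bind (k a) f)
  end.

Fixpoint result s X (p : prog X) : X :=
  match p with Ret x => x | Ask v k => result s (k (s v)) end.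

Fixpoint cost s X (p : prog X) : nat :=
  match p with Ret _ => 0 | Ask v k => (cost s (k (s v))).+1 end.

Lemma result_bind s X Y (p : prog X) (f : X -> prog Y) :
  result s (bind p f) = result s (f (result s p)).
Proof. by elim: p => //= v k IH. Qed.

Lemma cost_bind s X Y (p : prog X) (f : X -> prog Y) :
  cost s (bind p f) = cost s p + cost s (f (result s p)).
Proof. by elim: p => //= v k IH; rewrite IH. Qed.

Fixpoint foldM T X (f : X -> T -> prog X) (x : X) (l : seq T) : prog X :=
  if l is y :: l' then bind (f x y) (fun x' => foldM f x' l') else Ret x.

Lemma result_foldM s T X (f : X -> T -> prog X) x l :
  result s (foldM f x l) = foldl (fun x y => result s (f x y)) x l.
Proof. by elim: l x => //= y l IH x; rewrite result_bind IH. Qed.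

Lemma cost_foldM s T X (f : X -> T -> prog X) B x l :
  (forall x y, cost s (f x y) <= B) -> cost s (foldM f x l) <= size l * B.
Proof.
by move=> fB; elim: l x => //= y l IH x; rewrite cost_bind mulSn leq_add.
Qed.

(** The history is replayed along the tree; its answers alone determine the position. *)
Fixpoint strat (p : prog (vertex n)) : strategy n := fun h =>
  match p, h with
  | Ret t, _ => Output t
  | Ask v _, [::] => Query v
  | Ask _ k, (_, a) :: h' => strat (k a) h'
  end.

Lemma exec_strat s (p : prog (vertex n)) q :
  cost s p <= q -> exec (strat p) s q [::] = Some (result s p).
Proof.
(* The induction needs a strategy that agrees with [strat p] only on extensions of the current
   history [h]. *)
suff gen A h : (forall g, A (h ++ g) = strat p g) -> cost s p <= q ->
    exec A s q h = Some (result s p) by apply: gen.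
elim: p q h => [t|v k IH] q h HA.
  by have := HA [::]; rewrite cats0 => Ah _; case: q => [|q] /=; rewrite Ah.
case: q => //= q; rewrite ltnS => leq; have := HA [::]; rewrite cats0 => -> /=.
by apply: IH => // g; rewrite cat_rcons HA.
Qed.

Definition ask_all (l : seq (vertex n)) : prog (outmap n) :=
  foldM (fun m u => Ask u (fun a => Ret (fun z => if z == u then a else m z)))
        (fun=> set0) l.

Lemma result_ask_all s l u : u \in l -> result s (ask_all l) u = s u.
Proof.
rewrite /ask_all result_foldM; move: (fun=> set0) => m ul.
(* Invariant of the fold: [u] is still to be queried or already recorded correctly. *)
have : (u \in l) || (m u == s u) by rewrite ul.
elim: l m {ul} => [|z l IH] m /=; first by move/eqP.
rewrite inE => H; apply: IH; move: H; case: eqVneq => [->|_] //=.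
by rewrite eqxx orbT.
Qed.

(** The fuel [k] bounds the distance between [x] and [y], which drops in each round. In a USO,
    finding no [c] means [x = y]. *)
Fixpoint join (k : nat) x y : prog (vertex n) :=
  if k is k'.+1 then
    Ask x (fun a => Ask y (fun b =>
      if [pick c in symdiff x y | (c \in a) || (c \in b)] is Some c then
        if c \in a then join k' (flip x c) y else join k' x (flip y c)
      else Ret x))
  else Ret x.

Lemma cost_join s k x y : cost s (join k x y) <= k.*2.
Proof.
elim: k x y => //= k IH x y; rewrite doubleS !ltnS.
by case: pickP => [c _|] //=; case: ifP.
Qed.

Lemma join_connect s k x y : USO s -> #|symdiff x y| <= k ->
  connect (Defs.arc s) x (result s (join k x y)) && connect (Defs.arc s) y (result s (join k x y)).
Proof.
move=> us; elim: k x y => [|k IH] x y /=.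
  by rewrite leqn0 cards_eq0 symdiff_eq0 => /eqP->; rewrite connect0.
move=> lek; case: pickP => [c /andP[cD]|H] /=; last first.
  have -> : x = y.
    apply: (USO_sink_inj us) => c cD; have := H c.
    by rewrite cD -negb_or /= => ->.
  by rewrite connect0.
case: ifPn => [cx _|_ /= cy].
  have /IH/andP[xw yw] : #|symdiff (flip x c) y| <= k.
    by move: cD lek; rewrite symdiffC => cD; rewrite (card_symdiff_flip cD) symdiffC.
  by rewrite yw (connect_trans (connect_flip cx) xw).
have /IH/andP[xw yw] : #|symdiff x (flip y c)| <= k by rewrite -ltnS -card_symdiff_flip.
by rewrite xw (connect_trans (connect_flip cy) yw).
Qed.

Definition dominated v J (m : outmap n) : rel 'I_n :=
  fun k j => [&& k \in J, j \in J, j != k & k \notin m (flip v j)].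

Definition dominating v J m (T : {set 'I_n}) : bool :=
  (T \subset J) && [forall k in J, exists j in T, connect (dominated v J m) k j].

Definition min_dominating v J m : {set 'I_n} :=
  [arg min_(T < J | dominating v J m T) #|T|].

(** If [j] in [T] dominated another [k] in [T], then [k] could be dropped, since chains ending in
    [k] extend to [j]. Minimal size thus replaces successive discarding. *)
Lemma min_dominatingP v J m (T := min_dominating v J m) :
  [/\ T \subset J,
      forall k, k \in J -> exists2 j, j \in T & connect (dominated v J m) k j
    & forall j k, j \in T -> k \in T -> k != j -> k \in m (flip v j)].
Proof.
have J0 : dominating v J m J.
  rewrite /dominating subxx; apply/forall_inP=> k kJ; apply/exists_inP.
  by exists k.
rewrite /T /min_dominating; case: arg_minnP => // {}T /andP[TJ /forall_inP domT] minT.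
split=> // [k /domT/exists_inP //|j k jT kT kj].
apply: contraT => kmj; have /minT : dominating v J m (T :\ k).
  rewrite /dominating (subset_trans (subsetDl _ _) TJ); apply/forall_inP=> l lJ.
  have /exists_inP[l' l'T ll'] := domT l lJ; apply/exists_inP.
  have [l'k|l'k] := eqVneq l' k; last by exists l'; rewrite // !inE l'k.
  exists j; first by rewrite !inE eq_sym kj.
  apply: connect_trans ll' _; apply: connect1.
  by rewrite /dominated l'k !(subsetP TJ) // eq_sym kj.
by rewrite (cardsD1 k T) kT ltnn.
Qed.

(* The index is shifted: [descend k v] handles the vertices at distance at most
   k + 1 from v. *)
Fixpoint descend (k : nat) v : prog (vertex n) :=
  Ask v (fun J =>
    if k is k'.+1 then
      foldM (fun x j => bind (descend k' (flip v j)) (join n x)) v (enum J)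
    else
      bind (ask_all [seq flip v j | j <- enum J])
           (fun m => Ret (symdiff v (min_dominating v J m)))).

(** At [k = 0], at most [n + 1 <= 2 * n] queries are made. Each further level adds one query and at
    most [n] joins of cost at most [2 * n], and [2 * n ^ 2 + 1] is at most three times the new power
    of [n]. *)
Lemma cost_descend s k v : 0 < n -> cost s (descend k v) <= (3 * k).+2 * n ^ k.+1.
Proof.
move=> n0; elim: k v => [|k IH] v /=.
  rewrite cost_bind /= addn0.
  have := @cost_foldM s _ _
    (fun m u => Ask u (fun a => Ret (fun z => if z == u then a else m z))) 1
    (fun=> set0) [seq flip v j | j <- enum (s v)] (fun _ _ => leqnn _).
  rewrite size_map muln1 -cardE => /leq_ltn_trans -> //.
  apply: (@leq_trans n.+1); first by rewrite ltnS (leq_trans (max_card _)) ?card_ord.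
  by rewrite muln0 expn1 mul2n -addnn -addn1 leq_add2l.
have Bn x j : cost s (bind (descend k (flip v j)) (join n x)) <=
    (3 * k).+2 * n ^ k.+1 + n.*2.
  by rewrite cost_bind leq_add // cost_join.
apply: leq_ltn_trans (cost_foldM _ _ Bn) _.
have szn : size (enum (s v)) <= n by rewrite -cardE (leq_trans (max_card _)) ?card_ord.
apply: leq_ltn_trans (leq_mul szn (leqnn _)) _.
have ge2 : n * n <= n ^ k.+2 by rewrite !expnS mulnA leq_pmulr // expn_gt0 n0.
have ge1 : 0 < n ^ k.+2 by rewrite expn_gt0 n0.
have -> : (3 * k.+1).+2 = (3 * k).+2 + 3 by rewrite mulnS addnC !addSn.
rewrite mulnDr mulnCA -expnS -muln2 mulnA mulnDl ltn_add2l.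
apply: leq_ltn_trans (leq_mul ge2 (leqnn 2)) _.
by rewrite [X in X < _]mulnC ltn_pmul2r.
Qed.

Lemma symdiffK v J : symdiff v (symdiff v J) = J.
Proof. by apply/setP=> j; rewrite !in_symdiff addKb. Qed.

Lemma descend_connect s k v u : USO s -> dist_le s k.+1 v u ->
  connect (Defs.arc s) u (result s (descend k v)).
Proof.
move=> us; elim: k v u => [|k IH] v u.
  rewrite /= result_bind /=; set m := result s _.
  have mE j : j \in s v -> m (flip v j) = s (flip v j).
    by move=> jv; apply/result_ask_all/map_f; rewrite mem_enum.
  have [] := min_dominatingP v (s v) m; set T := min_dominating _ _ _ => Tv domT Tm.
  have ujT j : j \in T -> connect (Defs.arc s) (flip v j) (symdiff v T).
    move=> jT; apply: connect_source => //; apply/subsetP=> c.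
    rewrite !in_symdiff in_flip addbACA addbb /= addbC.
    have [-> |cj] := eqVneq c j; first by rewrite jT.
    by rewrite addbF => cT; rewrite -mE ?(subsetP Tv) // Tm.
  case/orP=> [/eqP <-|/existsP[w /andP[/existsP[k /andP[kv /eqP->]] /eqP <-]]].
    (* For [u = v]: as [T] lies in [s v], [v] is itself the source of the face it spans with
       [symdiff v T]. *)
    by apply: connect_source; rewrite ?symdiffK.
  have [j jT kj] := domT k kv; apply: connect_trans (ujT j jT).
  case/connectP: kj => p; elim: p k {kv} => [|l p IHp] k /=.
    by move=> _ ->.
  case/andP=> /and4P[kv lv lk kml] pth /(IHp _ pth); apply: connect_trans.
  by apply: connect_2face; rewrite // -mE.
have joinE x y : connect (Defs.arc s) x (result s (join n x y)) &&
    connect (Defs.arc s) y (result s (join n x y)).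
  by apply: join_connect => //; rewrite (leq_trans (max_card _)) ?card_ord.
rewrite /= result_foldM; move=> H.
pose f x j := result s (bind (descend k (flip v j)) (join n x)).
(* The accumulator only moves along directed paths, so whatever reaches it at some stage reaches the
   result. It starts at [v], which settles [u = v]. *)
rewrite -/f; have mono l x : connect (Defs.arc s) x (foldl f x l).
  elim: l x => //= j l IHl x; apply: connect_trans (IHl _).
  by rewrite /f result_bind; have /andP[] := joinE x (result s (descend k (flip v j))).
case/orP: H => [/eqP <- //|/existsP[w /andP[/existsP[j /andP[jv /eqP->]] vu]]].
have /= := IH (flip v j) u vu; move: (jv); rewrite -mem_enum.
elim: (enum _) (v in foldl _ v) => //= i l IHl x; rewrite inE => /orP[/eqP<-|jl] uw; last exact: IHl.
apply: connect_trans (mono _ _); rewrite /f result_bind; apply: connect_trans uw _.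
by have /andP[] := joinE x (result s (descend k (flip v j))).
Qed.

Lemma dist_le_refl s k v : dist_le s k v v.
Proof. by case: k => [|k] /=; rewrite eqxx. Qed.

(** Away from the sink, the covering vertex reaches the result. At the sink the reachmap is empty
    and [descend] stays there, which the truncated [.-1] allows. *)
Lemma reachmap_descend s k v : USO s -> nice k.+1 s ->
  #|reachmap s (result s (descend k v))| <= #|reachmap s v|.-1.
Proof.
move=> us ni; have [v0|/ni[u /andP[du ru]]] := eqVneq (s v) set0.
  have vd := descend_connect us (dist_le_refl s k.+1 v).
  rewrite (connect_sink v0 vd) leqNgt; case E: #|_| => //.
  suff r0 : reachmap s v = set0 by rewrite r0 cards0 in E.
  apply/setP=> j; rewrite !inE v0 inE; apply/existsP=> -[w /andP[vw]].
  by rewrite (connect_sink v0 vw) v0 inE.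
have := proper_card ru; case: #|reachmap s v| => // r; rewrite ltnS.
by apply/leq_trans/subset_leq_card/reachmap_connect/descend_connect.
Qed.

(** * Iteration down to the global sink *)

Definition find_sink (k : nat) : prog (vertex n) :=
  foldM (fun v _ => descend k v) set0 (enum 'I_n).

Lemma find_sink_result s k : USO s -> nice k.+1 s -> s (result s (find_sink k)) = set0.
Proof.
move=> us ni; rewrite /find_sink result_foldM.
suff gen (l : seq 'I_n) v : #|reachmap s v| <= size l ->
    s (foldl (fun u _ => result s (descend k u)) v l) = set0.
  by apply: gen; rewrite size_enum_ord (leq_trans (max_card _)) ?card_ord.
elim: l v => [|j l IH] v /=.
  by rewrite leqn0 cards_eq0 -!subset0 => /(subset_trans (subsetUl _ _)); rewrite subset0 => /eqP.
by move=> lel; apply/IH/(leq_trans (reachmap_descend v us ni)); case: #|_| lel.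
Qed.

Lemma find_sink_cost s k : 0 < n ->
  cost s (find_sink k) <= (3 * k).+2 * n ^ k.+2.
Proof.
move=> n0; rewrite expnS mulnCA -{2}[n]size_enum_ord.
by apply: cost_foldM => v _; apply: cost_descend.
Qed.

(** A vertex within distance 0 of [v] is [v], which does not cover itself. So every vertex would be
    a sink, contradicting the orientation of any edge. *)
Lemma nice0_false s : 0 < n -> is_orientation s -> nice 0 s -> False.
Proof.
move=> n0 or ni; pose j := Ordinal n0.
have nz v : j \notin s v.
  apply/negP=> jv; have /ni[u /andP[/eqP <-]] : s v != set0 by apply/set0Pn; exists j.
  by rewrite properxx.
by have := nz set0; rewrite or (nz (flip set0 j)).
Qed.

End Cube.

Theorem theorem6 :
  forall i : nat,
  exists (A : forall n : nat, strategy n) (C : nat),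
  forall (n : nat) (s : outmap n),
    0 < n -> USO s -> nice i s ->
    exists t : vertex n,
      exec (A n) s (C * n ^ i.+1) [::] = Some t /\ s t = set0.
Proof.
case=> [|k].
  (* The case [i = 0] is vacuous, so any algorithm serves. *)
  exists (fun n _ => Output set0), 0 => n s n0 [or _] ni.
  by case: (nice0_false n0 or ni).
exists (fun n => strat (find_sink n k)), (3 * k).+2 => n s n0 us ni.
exists (result s (find_sink n k)); split; last exact: find_sink_result.
by apply/exec_strat/find_sink_cost.
Qed.
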